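(* Let $\alpha\vdash k$. Then for all integers $n\geq 0$, $$ N(n+k;\alpha)= \sum_{j=0}^k \binom{n}{j}\left( \sum_{\mu\vdash k-j} f^{\alpha/\mu}\right) t_{n-j}. $$
   Context: A standard Young tableau (SYT) of (possibly skew) shape is a filling of the cells of the diagram by $1,2,\dots$ (each once) increasing along rows and down columns. For a partition $\alpha\vdash k$ and a fixed SYT $T$ of shape $\alpha$, $N(m;\alpha)$ denotes the number of SYT with $m$ cells that contain $T$ as a subtableau (i.e. whose entries $1,\dots,k$ form exactly $T$); equivalently $N(m;\alpha)=\sum_{\lambda\vdash m} f^{\lambda/\alpha}$, where $f^{\lambda/\mu}$ is the number of SYT of skew shape $\lambda/\mu$ (taken to be $0$ if $\mu\not\subseteq\lambda$, and $1$ if $\lambda=\mu$). $t_m$ denotes the number of involutions in the symmetric group $\mathfrak{S}_m$ (with $t_0=1$); terms with $j>n$ vanish because of the binomial coefficient. *)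

(* Defs.v *)
From HB Require Import structures.
From mathcomp Require Import all_boot all_fingroup.

Set Implicit Arguments.
Unset Strict Implicit.
Unset Printing Implicit Defensive.

(* Partitions of m are padded with zeros to length exactly m, so that they     *)
(* form a finite type in which each partition of m occurs exactly once.        *)
Definition is_partition (m : nat) (p : m.-tuple 'I_m.+1) : bool :=
  sorted geq (map val p) && (sumn (map val p) == m).

Definition intpart (m : nat) := {p : m.-tuple 'I_m.+1 | is_partition p}.

Definition parts (m : nat) (p : intpart m) : seq nat := map val (val p).
Coercion parts : intpart >-> seq.

Definition subshape (mu la : seq nat) : bool :=
  all (fun i => nth 0 mu i <= nth 0 la i) (iota 0 (size mu)).

(* Cells are (row, column), both numbered from 0.                              *)
Definition skew_diagram (la mu : seq nat) : seq (nat * nat) :=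
  [seq (i, j) | i <- iota 0 (size la),
                j <- iota (nth 0 mu i) (nth 0 la i - nth 0 mu i)].

Definition cell (la mu : seq nat) := seq_sub (skew_diagram la mu).

Definition filling (la mu : seq nat) :=
  {ffun cell la mu -> 'I_(size (skew_diagram la mu)).+1}.

(* Positivity and injectivity together say that 1, ..., N are used once each,  *)
(* N being the number of cells.                                                *)
Definition is_syt (la mu : seq nat) (t : filling la mu) : bool :=
  [&& [forall c, 0 < t c],
      injectiveb t,
      [forall c, forall d,
         ((val c).1 == (val d).1) && ((val c).2 < (val d).2) ==> (t c < t d)]
    & [forall c, forall d,
         ((val c).2 == (val d).2) && ((val c).1 < (val d).1) ==> (t c < t d)]].

(* Standard Young tableaux of skew shape la / mu, for mu contained in la.      *)
Definition syt (la mu : seq nat) := {t : filling la mu | is_syt t}.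

Definition entry (la mu : seq nat) (t : syt la mu) (c : cell la mu) : nat :=
  val t c.

Definition num_syt (la mu : seq nat) : nat :=
  if subshape mu la then #|{: syt la mu}| else 0.

Definition contains_syt (la al : seq nat)
    (t : syt la [::]) (T : syt al [::]) : bool :=
  [forall c, (entry t c <= size (skew_diagram al [::]))
               == (val c \in skew_diagram al [::])] &&
  [forall c, forall d, (val c == val d) ==> (entry t c == entry T d)].

Definition syt_of_size (m : nat) := {la : intpart m & syt la [::]}.

Definition num_syt_containing (m : nat) (al : seq nat) (T : syt al [::]) : nat :=
  #|[set t : syt_of_size m | contains_syt (tagged t) T]|.

(* The identity counts as an involution.                                       *)
Definition num_involutions (m : nat) : nat :=
  #|[set s : 'S_m | (s * s == 1)%g]|.

(* Main.v *)
(* Write d_j(a) for the number of downward paths of length j from the shape a in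
   Young's lattice.  The up and down operators satisfy DU - UD = 1, whence
   D^j U = U D^j + j D^(j-1); since a shape has one more addable than removable
   box, summing d_j(b) over the shapes b covering a gives
   d_(j+1)(a) + d_j(a) + j d_(j-1)(a).  Together with t_(m+1) = t_m + m t_(m-1)
   this shows, by induction on n, that the number of upward paths of length n
   from a is sum_j C(n, j) d_j(a) t_(n-j).  The rows of the successive entries
   of a skew standard tableau encode such a path. *)

Require Import Defs.
From HB Require Import structures.
From mathcomp Require Import all_boot all_fingroup zify.

Set Implicit Arguments.
Unset Strict Implicit.
Unset Printing Implicit Defensive.

(** * Paths in Young's lattice and the commutation of adding and removing boxes *)

Definition decr (a : nat -> nat) := forall r, a r.+1 <= a r.

(** A shape is the function of its row lengths, so a box is added or removed pointwise and shapes
    are compared by [=1]. *)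
Definition inc (a : nat -> nat) (r i : nat) := a i + (i == r).
Definition dec (a : nat -> nat) (r i : nat) := a i - (i == r).
Definition addable (a : nat -> nat) (r : nat) := (r == 0) || (a r < a r.-1).
Definition removable (a : nat -> nat) (r : nat) := a r.+1 < a r.

(* Words record the row of each added box; only rows below B are considered. *)
Fixpoint up_words B n a : seq (seq nat) :=
  if n is n'.+1 then
    [seq r :: w | r <- [seq r <- iota 0 B | addable a r], w <- up_words B n' (inc a r)]
  else [:: [::]].

(** The box removed first is the last letter: read from left to right, a word climbs back up to
    [a]. *)
Fixpoint down_words B n a : seq (seq nat) :=
  if n is n'.+1 then
    [seq rcons w r | r <- [seq r <- iota 0 B | removable a r],
                     w <- down_words B n' (dec a r)]
  else [:: [::]].

Lemma size_up_wordsS B n a :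
  size (up_words B n.+1 a) =
    \sum_(0 <= r < B | addable a r) size (up_words B n (inc a r)).
Proof. by rewrite /= size_allpairs_dep sumnE big_map big_filter /index_iota subn0. Qed.

Lemma size_down_wordsS B n a :
  size (down_words B n.+1 a) =
    \sum_(0 <= r < B | removable a r) size (down_words B n (dec a r)).
Proof. by rewrite /= size_allpairs_dep sumnE big_map big_filter /index_iota subn0. Qed.

Arguments up_words : simpl never.
Arguments down_words : simpl never.

Lemma eq_size_down_words B n a b :
  a =1 b -> size (down_words B n a) = size (down_words B n b).
Proof.
elim: n a b => [|n IHn] a b eq_ab //; rewrite !size_down_wordsS.
apply: eq_big => [r|r _]; first by rewrite /removable !eq_ab.
by apply: IHn => i; rewrite /dec eq_ab.
Qed.

(** The two moves interact only if [r = s.+1]; then both sides say that row [s] exceeds row [r] by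
    at least two. *)
Lemma addable_removableC a r s :
  r != s -> addable a r && removable (inc a r) s =
            removable a s && addable (dec a s) r.
Proof.
rewrite /addable /removable /inc /dec => neq_rs.
case: r neq_rs => [|r] neq_rs /=; first lia.
case: (eqVneq r s) => [->|ne]; last by case: (eqVneq s.+1 r.+1) => [|_]; lia.
lia.
Qed.

Lemma removable_inc a r : decr a -> removable (inc a r) r.
Proof. by move=> da; move: (da r); rewrite /removable /inc; lia. Qed.

Lemma addable_dec a r : decr a -> removable a r -> addable (dec a r) r.
Proof.
rewrite /addable /removable /dec; case: r => [|r] // da; move: (da r) => /=; lia.
Qed.

Lemma decr_inc a r : decr a -> addable a r -> decr (inc a r).
Proof.
move=> da; rewrite /addable /inc => ad i; have := da i.
by case: (eqVneq i.+1 r) ad => [<-|ne] /=; lia.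
Qed.

Lemma decr_dec a r : decr a -> removable a r -> decr (dec a r).
Proof.
move=> da; rewrite /removable /dec => ad i; have := da i.
by case: (eqVneq i r) ad => [<-|ne] /=; lia.
Qed.

(* Every addable row but the first is one below a removable row. *)
Lemma count_addable B a : a B = 0 ->
  \sum_(0 <= r < B.+1 | addable a r) 1 = (\sum_(0 <= r < B.+1 | removable a r) 1).+1.
Proof.
move=> aB0; rewrite big_mkcond big_nat_recl // [in RHS]big_mkcond big_nat_recr //=.
by rewrite {2}/removable aB0 ltn0 addn0 add1n.
Qed.

(** Spreads a multiple of a count over the diagonal of a double sum, so that it can be merged with
    off-diagonal terms. *)
Lemma sum_diag B (P : pred nat) c :
  \sum_(r < B) \sum_(s < B) (if (r == s) && P r then c else 0) =
  c * \sum_(0 <= r < B | P r) 1.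
Proof.
rewrite big_mkord big_distrr /= [RHS]big_mkcond; apply: eq_bigr => r _.
rewrite (bigD1 r) //= eqxx /= big1 ?addn0 ?muln1 // => s.
by rewrite eq_sym => /negPf->.
Qed.

(** This is DU = UD + 1. Off the diagonal both double sums agree; on it each term is [f a], and [a]
    has one more addable than removable row. *)
Lemma sum_inc_dec B (f : (nat -> nat) -> nat) a :
  (forall b c, b =1 c -> f b = f c) -> decr a -> a B = 0 ->
  \sum_(0 <= r < B.+1 | addable a r)
     \sum_(0 <= s < B.+1 | removable (inc a r) s) f (dec (inc a r) s) =
  f a + \sum_(0 <= s < B.+1 | removable a s)
     \sum_(0 <= r < B.+1 | addable (dec a s) r) f (inc (dec a s) r).
Proof.
move=> eqf da aB0.
(* [G] is the off-diagonal part common to both double sums. *)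
pose G (r s : 'I_B.+1) := if (r != s) && (removable a s && addable (dec a s) r)
  then f (inc (dec a s) r) else 0.
have -> : \sum_(0 <= r < B.+1 | addable a r)
     \sum_(0 <= s < B.+1 | removable (inc a r) s) f (dec (inc a r) s) =
  \sum_r \sum_s G r s + f a * \sum_(0 <= r < B.+1 | addable a r) 1.
  rewrite -sum_diag -big_split big_mkord big_mkcond /=; apply: eq_bigr => r _.
  rewrite -big_split big_mkord /=; case: ifP => ad; last first.
    rewrite big1 // => s _; rewrite andbF addn0 /G.
    by case: eqVneq => //= ne; rewrite -addable_removableC // ad.
  rewrite big_mkcond; apply: eq_bigr => s _; rewrite /G.
  case: (eqVneq r s) => [<-|ne] /=.
    by rewrite removable_inc //; apply: eqf => i; rewrite /dec /inc; lia.
  rewrite -addable_removableC // ad addn0 /=; case: ifP => // re.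
  apply: eqf => i; have ne' : (r : nat) != s by [].
  move: re; rewrite /removable /dec /inc.
  by case: (eqVneq i s) => [->|]; lia.
have -> : \sum_(0 <= s < B.+1 | removable a s)
     \sum_(0 <= r < B.+1 | addable (dec a s) r) f (inc (dec a s) r) =
  \sum_r \sum_s G r s + f a * \sum_(0 <= r < B.+1 | removable a r) 1.
  rewrite -sum_diag exchange_big [X in _ + X]exchange_big -big_split.
  rewrite big_mkord big_mkcond /=; apply: eq_bigr => s _.
  rewrite -big_split big_mkord /=; case: ifP => re; last first.
    rewrite big1 // => r _; rewrite /G re andbF /=.
    by case: eqVneq => //= ->; rewrite re.
  rewrite big_mkcond; apply: eq_bigr => r _; rewrite /G.
  case: (eqVneq r s) => [->|ne] /=.
    rewrite re addable_dec //; apply: eqf => i; move: re.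
    by rewrite /removable /dec /inc; case: eqVneq => [->|]; lia.
  by rewrite re addn0.
by rewrite count_addable // mulnS addnCA.
Qed.

(** Induction on [j]: [sum_inc_dec] carries the added box past the first removal, and the hypothesis
    applies one level below [a]. *)
Lemma sum_down_words_inc B j a : decr a -> a B = 0 ->
  \sum_(0 <= r < B.+1 | addable a r) size (down_words B.+1 j (inc a r)) =
  size (down_words B.+1 j.+1 a) + size (down_words B.+1 j a) +
  j * size (down_words B.+1 j.-1 a).
Proof.
elim: j a => [|j IHj] a da aB0.
  by rewrite size_down_wordsS mul0n addn0 /= count_addable // addn1.
under eq_bigr do rewrite size_down_wordsS.
rewrite (sum_inc_dec (f := fun b => size (down_words B.+1 j b))) //; last first.
  by move=> b c /eq_size_down_words.
have -> : \sum_(0 <= s < B.+1 | removable a s)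
     \sum_(0 <= r < B.+1 | addable (dec a s) r)
        size (down_words B.+1 j (inc (dec a s) r)) =
  \sum_(0 <= s < B.+1 | removable a s)
    (size (down_words B.+1 j.+1 (dec a s)) + size (down_words B.+1 j (dec a s)) +
     j * size (down_words B.+1 j.-1 (dec a s))).
  apply: eq_bigr => s re; rewrite IHj //; first exact: decr_dec.
  by rewrite /dec aB0.
rewrite !big_split -big_distrr -!size_down_wordsS /=.
(* The last sum reassembles into words of length [j.-1.+1], which is [j] unless [j = 0], where its
   coefficient vanishes. *)
case: j {IHj} => [|j] /=; first by rewrite !mul0n mul1n addn0 addnC.
by rewrite [j.+2 * _]mulSn; lia.
Qed.

(** * Counting upward paths with the involution recurrence *)

(** Absorption turns [j.+1 * 'C(n, j.+1)] into [(n - j) * 'C(n, j)]; the recurrence of [t] at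
    [n - j] and Pascal's rule finish. Beyond [n], only [j = n.+1] gives nonzero terms. *)
Lemma bin_rec_involutions (t : nat -> nat) n j :
  t 0 = 1 -> (forall m, t m.+1 = t m + m * t m.-1) ->
  'C(n.+1, j) * t (n.+1 - j) =
  (if j is j'.+1 then 'C(n, j') * t (n - j') else 0) + 'C(n, j) * t (n - j) +
  j.+1 * ('C(n, j.+1) * t (n - j.+1)).
Proof.
move=> t0 tS; case: (leqP j n) => [le_jn|lt_nj]; last first.
  rewrite (bin_small lt_nj) (@bin_small n j.+1) ?mul0n ?muln0 ?addn0; last lia.
  case: j lt_nj => // j; rewrite ltnS leq_eqVlt => /predU1P[->|lt_nj].
    by rewrite !binn !subnn.
  by rewrite !bin_small ?mul0n //; lia.
have -> : j.+1 * ('C(n, j.+1) * t (n - j.+1)) = 'C(n, j) * ((n - j) * t (n - j).-1).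
  by rewrite !mulnA mul_bin_left (mulnC (n - j)) subnS.
rewrite -addnA -mulnDr -tS -subSn //.
by case: j le_jn => [|j] le_jn; rewrite ?bin0 // binS subSS mulnDl addnC.
Qed.

(** The last hypothesis makes all rows from [B - n] on empty. Each added box uses up at most one of
    them, so row [B] stays empty, as [sum_down_words_inc] requires. *)
Lemma size_up_words (t : nat -> nat) B n a :
  t 0 = 1 -> (forall m, t m.+1 = t m + m * t m.-1) ->
  n <= B -> decr a -> (forall i, B <= n + i -> a i = 0) ->
  size (up_words B.+1 n a) =
    \sum_(0 <= j < n.+1) 'C(n, j) * size (down_words B.+1 j a) * t (n - j).
Proof.
move=> t0 tS; elim: n a => [|n IHn] a le_nB da a0.
  by rewrite big_nat1 /= t0.
have aB0 : a B = 0 by apply: a0; lia.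
rewrite size_up_wordsS.
have -> : \sum_(0 <= r < B.+1 | addable a r) size (up_words B.+1 n (inc a r)) =
  \sum_(0 <= r < B.+1 | addable a r) \sum_(0 <= j < n.+1)
    'C(n, j) * size (down_words B.+1 j (inc a r)) * t (n - j).
  apply: eq_bigr => r ad; apply: IHn => [||i le]; [lia|exact: decr_inc|].
  have := ad; rewrite /inc /addable (a0 i); last lia.
  case: r {ad} => [|r]; first by lia.
  case: (leqP B (n.+1 + r)) => [/a0 ->//|]; lia.
rewrite exchange_big /=.
under eq_bigr => j _.
  under eq_bigr do rewrite mulnAC.
  rewrite -big_distrr sum_down_words_inc //= !mulnDr.
  over.
pose d j := size (down_words B.+1 j a).
rewrite [RHS](eq_bigr (fun j =>
   (if j is j'.+1 then 'C(n, j') * t (n - j') else 0) * d j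
     + 'C(n, j) * t (n - j) * d j +
  j.+1 * ('C(n, j.+1) * t (n - j.+1)) * d j)); last first.
  by move=> j _; rewrite mulnAC bin_rec_involutions // !mulnDl.
(* The terms in [d j.+1], [d j] and [d j.-1] are matched separately, up to a shift of the index. *)
rewrite !big_split /= -/d; congr (_ + _ + _).
- by rewrite [RHS]big_nat_recl.
- by rewrite [RHS]big_nat_recr //= bin_small // addn0.
(* The term [j = 0] on the left and the terms [j = n] and [j = n.+1] on the right vanish. *)
rewrite big_nat_recl // [RHS]big_nat_recr //= [in RHS]big_nat_recr //=.
rewrite (@bin_small n n.+1) // (@bin_small n n.+2) // !(mul0n, muln0, addn0) add0n.
by apply: eq_bigr => j _; rewrite mulnCA mulnA.
Qed.

(** * The recurrence for the number of involutions *)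

(** With the support as a parameter, points can be deleted inside one fixed type, without
    renumbering. *)
Definition involutions_on (T : finType) (A : {set T}) : {set {perm T}} :=
  [set s | perm_on A s && (s * s == 1)%g].

Lemma involutionP (T : finType) (s : {perm T}) :
  reflect (involutive s) (s * s == 1)%g.
Proof.
apply: (iffP eqP) => [ss x|ss]; first by rewrite -permM ss perm1.
by apply/permP=> x; rewrite permM ss perm1.
Qed.

Lemma in_involutions_on (T : finType) (A : {set T}) s :
  (s \in involutions_on A) = perm_on A s && (s * s == 1)%g.
Proof. by rewrite inE. Qed.

Lemma card_involutions_on0 (T : finType) : #|involutions_on (set0 : {set T})| = 1.
Proof.
rewrite -(cards1 (1%g : {perm T})); congr #|pred_of_set _|; apply/setP=> s.
rewrite !inE; apply/andP/eqP => [[/subsetP s0 _]|->]; last by rewrite perm_on1 mulg1.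
apply/permP=> x; rewrite perm1; apply/eqP/negPn/negP => /s0.
by rewrite inE.
Qed.

Lemma perm_on_setU1 (T : finType) (x : T) (A : {set T}) s :
  x \notin A -> perm_on A s = perm_on (x |: A) s && (s x == x).
Proof.
move=> xA; apply/idP/andP => [sA|[sA /eqP sx]].
  split; last by rewrite (out_perm sA).
  by apply: subset_trans sA _; exact: subsetUr.
apply/subsetP => y sy; have := subsetP sA _ sy.
by rewrite in_setU1 => /predU1P[eq|//]; move: sy; rewrite eq inE sx eqxx.
Qed.

(** Multiplication by [tperm x y] is the bijection: it splits off the 2-cycle that exchanges [x] and
    [y]. *)
Lemma card_involutions_swap (T : finType) (x y : T) (A : {set T}) :
  x \notin A -> y \in A ->
  #|[set s in involutions_on (x |: A) | s x == y]| = #|involutions_on (A :\ y)|.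
Proof.
move=> xA yA; have ne : x != y by apply: contraNneq xA => ->.
rewrite -(card_imset (involutions_on (A :\ y)) (mulIg (tperm x y))).
congr #|pred_of_set _|; apply/setP=> s; apply/idP/imsetP.
  rewrite !inE => /andP[/andP[sA /involutionP ss] /eqP sx].
  have sy : s y = x by rewrite -sx ss.
  exists (s * tperm x y)%g; last by rewrite -mulgA tperm2 mulg1.
  rewrite in_involutions_on; apply/andP; split; last first.
    apply/involutionP => z; rewrite !permM.
    case: (tpermP x y (s z)) => [szx|szy|szx szy].
    - by rewrite sy tpermL -[z]ss szx sx.
    - by rewrite sx tpermR -[z]ss szy sy.
    rewrite ss; case: tpermP => // zE; last by rewrite zE in szx; case: szx.
    by rewrite zE in szy; case: szy.
  apply/subsetP => z; rewrite inE permM in_setD1 => sz.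
  have zx : z != x by apply: contraNneq sz => ->; rewrite sx tpermR.
  have zy : z != y by apply: contraNneq sz => ->; rewrite sy tpermL.
  rewrite zy /=; have := subsetP sA z; rewrite in_setU1 (negPf zx); apply.
  by apply: contraNneq sz => ->; rewrite tpermD // eq_sym.
case=> u; rewrite in_involutions_on => /andP[uA /involutionP uu] ->.
have ux : u x = x by rewrite (out_perm uA) // in_setD1 (negPf xA) andbF.
have uy : u y = y by rewrite (out_perm uA) // in_setD1 eqxx.
rewrite !inE permM ux tpermL eqxx andbT; apply/andP; split.
  apply/subsetP => z; rewrite inE permM in_setU1.
  case: (eqVneq z x) => //= zx; case: (eqVneq z y) => [->//|zy] uz.
  have := subsetP uA z; rewrite in_setD1 zy; apply.
  by apply: contraNneq uz => ->; rewrite tpermD // eq_sym.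
apply/involutionP => z; rewrite !permM.
case: (eqVneq z x) => [->|zx]; first by rewrite ux tpermL uy tpermR.
case: (eqVneq z y) => [->|zy]; first by rewrite uy tpermR ux tpermL.
rewrite (@tpermD _ x y (u z)) ?uu; last 2 first.
- by apply: contraNneq zx => xu; rewrite -[z]uu -xu ux.
- by apply: contraNneq zy => yu; rewrite -[z]uu -yu uy.
by rewrite tpermD // eq_sym.
Qed.

(** Involutions are sorted by the image of [x]: either [x] is fixed, or it is exchanged with some
    [y] in [A]. *)
Lemma card_involutions_onU1 (T : finType) (x : T) (A : {set T}) : x \notin A ->
  #|involutions_on (x |: A)| =
    #|involutions_on A| + \sum_(y in A) #|involutions_on (A :\ y)|.
Proof.
move=> xA; rewrite -sum1_card (partition_big (fun s : {perm T} => s x) (mem (x |: A))).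
  rewrite (big_setU1 x) //=; congr (_ + _).
    rewrite sum1_card; apply: eq_card => s.
    by rewrite unfold_in /= !in_involutions_on (perm_on_setU1 _ xA) andbAC.
  apply: eq_bigr => y yA; rewrite -(card_involutions_swap xA yA) sum1_card.
  by apply: eq_card => s; rewrite [in RHS]inE.
move=> s; rewrite in_involutions_on => /andP[sA _].
case: (eqVneq (s x) x) => [->|ne]; first exact: setU11.
by rewrite /= (perm_closed x sA) setU11.
Qed.

(* The pair (t_m, t_(m-1)); the second component is junk at m = 0. *)
Fixpoint involution_numbers m : nat * nat :=
  if m is m'.+1 then
    let: (p, q) := involution_numbers m' in (p + m' * q, p)
  else (1, 1).

Lemma card_involutions_on (T : finType) (A : {set T}) :
  #|involutions_on A| = (involution_numbers #|A|).1.
Proof.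
(* Strong induction on a bound for the cardinal, since the recurrence removes one point or two. *)
elim/ltn_ind: {A}_.+1 {-2}A (ltnSn #|A|) => m IHm A leAm.
case: (set_0Vmem A) => [->|[x xA]]; first by rewrite card_involutions_on0 cards0.
rewrite -(setD1K xA) card_involutions_onU1 ?setD11 // cardsU1 setD11 add1n.
set C := A :\ x.
have ltCA : #|C| < #|A| by rewrite [#|A|](cardsD1 x) xA.
have IH (D : {set T}) : #|D| < #|A| -> #|involutions_on D| = (involution_numbers #|D|).1.
  by move=> ltDA; apply: (IHm #|A|) => //; lia.
rewrite /= (surjective_pairing (involution_numbers #|C|)) /= IH //; congr (_ + _).
(* For empty [C] both sides are [1], by the choice of the junk value. *)
have q : (involution_numbers #|C|).2 = (involution_numbers #|C|.-1).1.
  by case: #|C| => [|c] //=; case: involution_numbers.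
rewrite q -sum_nat_const; apply: eq_bigr => y yC.
have cC : #|C| = #|C :\ y|.+1 by rewrite (cardsD1 y) yC.
by rewrite IH ?cC //; lia.
Qed.

Lemma num_involutionsE m : num_involutions m = (involution_numbers m).1.
Proof.
rewrite -[in RHS](card_ord m) -cardsT -card_involutions_on; apply: eq_card => s.
rewrite !inE; case: (_ == _); rewrite ?andbF // andbT.
by apply/esym/subsetP => x; rewrite inE.
Qed.

Lemma num_involutions0 : num_involutions 0 = 1.
Proof. by rewrite num_involutionsE. Qed.

Lemma num_involutionsS m :
  num_involutions m.+1 = num_involutions m + m * num_involutions m.-1.
Proof.
rewrite !num_involutionsE /=; case: m => [|m] //=.
by case: (involution_numbers m).
Qed.

(** * Path words as chains of partitions *)

(** The lattice-word condition relative to [a]: each prefix of [w] leads to a partition. For [i]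
    past the end, [take i w] is [w] again. *)
Definition chain (a : nat -> nat) (w : seq nat) :=
  forall i, decr (fun r => a r + count_mem r (take i w)).

Lemma chain0 a w : chain a w -> decr a.
Proof. by move=> ch r; have := ch 0 r; rewrite take0 /= !addn0. Qed.

Lemma chain_cons a r w : chain a (r :: w) <-> decr a /\ chain (inc a r) w.
Proof.
have E i s : a s + count_mem s (take i.+1 (r :: w)) =
             inc a r s + count_mem s (take i w).
  by rewrite /= /inc eq_sym addnA.
split=> [ch|[da ch] [|i] s]; last by rewrite !E; exact: ch.
  by split=> [|i s]; [exact: chain0 ch | rewrite -!E; exact: ch].
by rewrite take0 /= !addn0.
Qed.

Lemma chain_cat a w v :
  chain a (w ++ v) <-> chain a w /\ chain (fun r => a r + count_mem r w) v.
Proof.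
split=> [ch|[cw cv] i r].
  split=> i r.
    case: (leqP i (size w)) => [le|/ltnW le].
      by have := ch i r; rewrite takel_cat.
    by have := ch (size w) r; rewrite take_size_cat // take_oversize.
  have := ch (size w + i) r.
  by rewrite takeD take_size_cat // drop_size_cat // !count_cat !addnA.
rewrite take_cat; case: ltnP => _; first exact: cw.
by rewrite !count_cat !addnA; exact: cv.
Qed.

Lemma chain1 a r : decr a -> decr (inc a r) -> chain a [:: r].
Proof. by move=> da di; apply/chain_cons; split=> // i s; rewrite /= !addn0; exact: di. Qed.

Lemma eq_chain a b w : a =1 b -> chain a w -> chain b w.
Proof. by move=> eq_ab ch i r; rewrite -!eq_ab; exact: ch. Qed.

Lemma decr_inc_addable a r : decr (inc a r) -> addable a r.
Proof.
case: r => [|r] // di; have := di r; rewrite /addable /inc /= eqxx.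
by rewrite (ltn_eqF (ltnSn r)) addn1 addn0.
Qed.

Lemma mem_up_words B n a w : decr a ->
  w \in up_words B n a <-> [/\ size w = n, all (gtn B) w & chain a w].
Proof.
elim: n a w => [|n IHn] a w da.
  rewrite inE; split=> [/eqP->|[/size0nil->//]].
  by split=> // i r; rewrite /= !addn0; exact: da.
split.
  case/allpairsPdep=> r [v [+ + ->]]; rewrite mem_filter mem_iota => /andP[ad /= ltrB].
  case/(IHn _ _ (decr_inc da ad)) => sz le ch; rewrite sz ltrB le; split=> //.
  exact/chain_cons.
case: w => [|r v] [] // [sz] /= /andP[ltrB le] /chain_cons[_ ch].
have ad := decr_inc_addable (chain0 ch).
apply/allpairsPdep; exists r, v; split=> //; first by rewrite mem_filter ad mem_iota.
by apply/IHn => //; exact: decr_inc.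
Qed.

(** Exhibits the bottom shape [mu] of the path, so that a word can be matched with a tableau of
    shape [a / mu]. The induction peels off the last letter, the first box removed. *)
Lemma mem_down_words B n a w : decr a ->
  w \in down_words B n a <-> [/\ size w = n, all (gtn B) w &
    exists2 mu, (forall r : nat, mu r + count_mem r w = a r) & chain mu w].
Proof.
elim: n a w => [|n IHn] a w da.
  rewrite inE; split=> [/eqP->|[/size0nil->//]].
  by split=> //; exists a => [r|i r]; rewrite /= ?addn0.
split.
  case/allpairsPdep=> r [v [+ + ->]]; rewrite mem_filter mem_iota => /andP[re /= ltrB].
  case/(IHn _ _ (decr_dec da re)) => sz le [mu sum ch].
  rewrite size_rcons sz all_rcons /= ltrB le; split=> //.
  have eqa s : mu s + count_mem s v + (s == r) = a s.
    by move: re; rewrite sum /removable /dec; case: (eqVneq s r) => [->|]; lia.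
  exists mu => [s|]; first by rewrite -cats1 count_cat addnA /= addn0 (eq_sym r).
  rewrite -cats1; apply/chain_cat; split=> //; apply: chain1 => [|s].
    by move=> s; rewrite !sum; exact: decr_dec.
  by rewrite /inc !eqa.
case/lastP: w => [|v r] []; rewrite ?size_rcons // => -[sz].
rewrite all_rcons /= => /andP[ltrB le] [mu sum].
rewrite -cats1 => /chain_cat[ch1 /chain0 ch2].
have eqa s : mu s + count_mem s v + (s == r) = a s.
  by rewrite -sum -cats1 count_cat addnA /= addn0 (eq_sym r).
have re : removable a r.
  have := ch2 r; have := eqa r; have := eqa r.+1;
    rewrite /removable eqxx (gtn_eqF (ltnSn r)); lia.
apply/allpairsPdep; exists r, v; split; [by rewrite mem_filter re mem_iota| |exact: cats1].
apply/(IHn _ _ (decr_dec da re)); split=> //; exists mu => // s.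
by rewrite /dec -eqa addnK.
Qed.

Lemma up_words_uniq B n a : uniq (up_words B n a).
Proof.
elim: n a => [//|n IHn] a; apply: allpairs_uniq_dep => [|r _|].
- by rewrite filter_uniq ?iota_uniq.
- exact: IHn.
by move=> [r v] [r' v'] _ _ /= [-> ->].
Qed.

Lemma down_words_uniq B n a : uniq (down_words B n a).
Proof.
elim: n a => [//|n IHn] a; apply: allpairs_uniq_dep => [|r _|].
- by rewrite filter_uniq ?iota_uniq.
- exact: IHn.
by move=> [r v] [r' v'] _ _ /= /rcons_inj[-> ->].
Qed.

(** * Letter counts, and counting through a relation *)

Lemma sum_count_mem B w :
  all (gtn B) w -> \sum_(r < B) count_mem (val r) w = size w.
Proof.
elim: w => [_|x w IHw /= /andP[ltxB le]]; first by rewrite big1.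
rewrite big_split /= IHw // (bigD1 (Ordinal ltxB)) //= eqxx big1 // => r ne.
by apply/eqP; rewrite eqb0 eq_sym.
Qed.

Lemma sum_nth B (s : seq nat) : size s <= B -> \sum_(r < B) nth 0 s r = sumn s.
Proof.
elim: s B => [|x s IHs] [|B] //= le; first by rewrite big_ord0.
  by rewrite big1 // => r _; rewrite nth_nil.
by rewrite big_ord_recl /= IHs.
Qed.

Lemma count_take_nth i (w : seq nat) r : i < size w ->
  count_mem r (take i.+1 w) = count_mem r (take i w) + (nth 0 w i == r).
Proof. by move=> lt; rewrite (take_nth 0) // -cats1 count_cat /= addn0. Qed.

Lemma count_take_le i (w : seq nat) r : count_mem r (take i w) <= count_mem r w.
Proof. by rewrite -{2}(cat_take_drop i w) count_cat leq_addr. Qed.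

(** One-sided inequalities suffice: once the prefixes agree, the next letter of [w] has to be
    counted in [v] too, so it is the next letter of [v]. *)
Lemma eq_take_count K (w v : seq nat) : K <= size w -> K <= size v ->
  (forall i (r : nat), i <= K -> count_mem r (take i w) <= count_mem r (take i v)) ->
  take K w = take K v.
Proof.
elim: K => [|K IHK] ltw ltv le; first by rewrite !take0.
have e : take K w = take K v.
  by apply: IHK => [||i r leiK]; [exact: ltnW | exact: ltnW | exact/le/ltnW].
have := le K.+1 (nth 0 w K) (leqnn _); rewrite !(take_nth 0) // -!cats1 !count_cat e.
by rewrite leq_add2l /= eqxx !addn0 lt0b => /eqP->.
Qed.

(** A monotone predicate is determined by its threshold. This will define the entry of a cell as the
    first time at which it is filled. *)
Lemma find_iota_le (P : pred nat) N i :
  {homo P : m n / m <= n >-> m ==> n} -> P N ->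
  (find P (iota 0 N.+1) <= i) = P i.
Proof.
move=> homP PN; set s := iota 0 N.+1.
have hasP : has P s by apply/hasP; exists N => //; rewrite mem_iota ltnS leqnn.
have lt : find P s < N.+1 by rewrite -[X in _ < X](size_iota 0) -has_find.
apply/idP/idP => [le|Pi].
  have := nth_find 0 hasP; rewrite nth_iota // add0n => Pf.
  by have := homP _ _ le; rewrite Pf.
rewrite leqNgt; apply/negP => lti; have := before_find 0 lti.
by rewrite nth_iota ?add0n ?Pi //; lia.
Qed.

(** Tableaux and words are linked by a relation, with existence and uniqueness both ways, rather
    than by a pair of inverse maps. *)
Lemma card_rel (T : finType) (S : eqType) (A : {set T}) (s : seq S)
    (R : T -> S -> Prop) : uniq s ->
  (forall t, t \in A -> exists2 w, w \in s & R t w) ->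
  (forall w, w \in s -> exists2 t, t \in A & R t w) ->
  (forall t w v, R t w -> R t v -> w = v) ->
  (forall t u w, R t w -> R u w -> t = u) ->
  #|A| = size s.
Proof.
move=> + + + Rw Rt; elim: s A => [|w s IHs] A /=.
  move=> _ At _; apply/eqP; rewrite cards_eq0; apply/eqP/setP => t.
  by rewrite inE; apply/negP => /At[].
case/andP=> ws us At sA.
have [t tA Rtw] := sA w (mem_head _ _).
rewrite (cardsD1 t) tA (IHs (A :\ t)) // => [u|v vs].
  rewrite in_setD1 => /andP[ne /At[v]]; rewrite inE => /predU1P[->|vs] Ruv.
    by rewrite (Rt _ _ _ Ruv Rtw) eqxx in ne.
  by exists v.
have [|u uA Ruv] := sA v; first by rewrite inE vs orbT.
exists u => //; rewrite in_setD1 uA andbT; apply: contraNneq ws => eq.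
by move: Ruv; rewrite eq => /(Rw _ _ _ Rtw) ->.
Qed.

(** * Skew diagrams and the row words of tableaux *)

Lemma mem_skew_diagram la mu d :
  (d \in skew_diagram la mu) = (nth 0 mu d.1 <= d.2 < nth 0 la d.1).
Proof.
apply/allpairsPdep/andP => [[i [j [_]]]|[le lt]].
  by rewrite mem_iota => ? -> /=; lia.
exists d.1, d.2; rewrite !mem_iota; split; last by case: d {le lt}.
  by rewrite /= add0n ltnNge; apply: contraTN lt => ?; rewrite [nth 0 la _]nth_default.
by rewrite le; lia.
Qed.

Lemma skew_diagram_uniq la mu : uniq (skew_diagram la mu).
Proof.
apply: allpairs_uniq_dep => [|i _|]; rewrite ?iota_uniq //.
by move=> [? ?] [? ?] _ _ /= [-> ->].
Qed.

Lemma size_skew_diagram la mu :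
  size (skew_diagram la mu) = \sum_(r < size la) (nth 0 la r - nth 0 mu r).
Proof.
rewrite size_allpairs_dep sumnE big_map -{1}[size la]subn0 big_mkord.
by apply: eq_bigr => r _; rewrite size_iota.
Qed.

Lemma subshapeP mu la :
  reflect (forall r, nth 0 mu r <= nth 0 la r) (subshape mu la).
Proof.
apply: (iffP allP) => [le r|le r _]; last exact: le.
case: (leqP (size mu) r) => [lt|lt]; first by rewrite nth_default.
by apply: le; rewrite mem_iota.
Qed.

(** Functions on all pairs, constrained only on the diagram, keep the dependent type [syt] out of
    the combinatorics. *)
Definition syt_fun la mu (f : nat * nat -> nat) :=
  let D := skew_diagram la mu in
  [/\ forall d : nat * nat, d \in D -> 0 < f d <= size D,
      {in D &, injective f},
      {in D &, forall d d', d.1 = d'.1 -> d.2 < d'.2 -> f d < f d'} &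
      {in D &, forall d d', d.2 = d'.2 -> d.1 < d'.1 -> f d < f d'}].

(* w lists the rows of the cells in the order of their entries f: the second
   clause says that the entries at most i of each row form an initial segment,
   of length the number of occurrences of that row in take i w. *)
Definition row_word la mu (f : nat * nat -> nat) (w : seq nat) :=
  (forall r : nat, nth 0 mu r + count_mem r w = nth 0 la r) /\
  (forall (d : nat * nat) i, d \in skew_diagram la mu ->
     (f d <= i) = (d.2 < nth 0 mu d.1 + count_mem d.1 (take i w))).

Lemma row_word_letters la mu w :
  (forall r, nth 0 mu r + count_mem r w = nth 0 la r) -> all (gtn (size la)) w.
Proof.
move=> sum; apply/allP => r; rewrite -has_pred1 has_count => cr /=; rewrite ltnNge.
by apply: contraL cr => le; have := sum r; rewrite (nth_default _ le); lia.
Qed.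

Lemma size_row_word la mu w :
  (forall r, nth 0 mu r + count_mem r w = nth 0 la r) ->
  size w = size (skew_diagram la mu).
Proof.
move=> sum; rewrite size_skew_diagram -(sum_count_mem (row_word_letters sum)).
by apply: eq_bigr => r _; rewrite -sum addKn.
Qed.

(** The letter at position [i] is the row of the cell with entry [i.+1]. By induction on [i], that
    cell is the first one not yet filled in its row. *)
Lemma row_word_exists la mu f : subshape mu la -> syt_fun la mu f ->
  exists w, row_word la mu f w.
Proof.
move=> /subshapeP sub [f_rg f_inj f_row _].
set D := skew_diagram la mu in f_rg f_inj f_row *.
(* Pigeonhole: the entries are [size D] distinct numbers between [1] and [size D]. *)
have hit i : i < size D -> exists2 d, d \in D & f d = i.+1.
  move=> lt; have u : uniq (map f D) by rewrite map_inj_in_uniq ?skew_diagram_uniq.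
  have sub1 : {subset map f D <= iota 1 (size D)}.
    by move=> _ /mapP[d dD ->]; rewrite mem_iota; have := f_rg d dD; lia.
  have le1 : size (iota 1 (size D)) <= size (map f D) by rewrite size_iota size_map.
  have [_ /(_ i.+1)] := uniq_min_size u sub1 le1.
  rewrite mem_iota /= add1n ltnS lt => /mapP[d dD ->].
  by exists d.
pose c i := nth (0, 0) D (index i.+1 (map f D)).
have cP i : i < size D -> c i \in D /\ f (c i) = i.+1.
  move=> /hit[d dD fd].
  have md : i.+1 \in map f D by rewrite -fd map_f.
  have lt : index i.+1 (map f D) < size D by rewrite -(size_map f) index_mem.
  by split; [exact: mem_nth | rewrite -(nth_map _ 0) // nth_index].
pose w := mkseq (fun i => (c i).1) (size D).
have szw : size w = size D by rewrite size_mkseq.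
have key i : i <= size D ->
  (forall d : nat * nat, d \in D ->
     (f d <= i) = (d.2 < nth 0 mu d.1 + count_mem d.1 (take i w))) /\
  (forall r : nat, nth 0 mu r + count_mem r (take i w) <= nth 0 la r).
  elim: i => [_|i IHi lt].
    split=> [d dD|r]; rewrite take0 /= addn0 //; have /andP[gt0 _] := f_rg d dD.
    by move: dD; rewrite mem_skew_diagram => /andP[le _]; rewrite leqNgt gt0 ltnNge le.
  have [IH1 IH2] := IHi (ltnW lt); have [cD fc] := cP i lt.
  (* Otherwise the first free cell of this row lies to the left of [c i]; its entry is smaller, so
     it would already be filled. *)
  have c2 : (c i).2 = nth 0 mu (c i).1 + count_mem (c i).1 (take i w).
    apply/eqP; rewrite eqn_leq [X in _ && X]leqNgt -IH1 // fc ltnn andbT leqNgt.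
    apply/negP => lt2.
    have d'D : ((c i).1, nth 0 mu (c i).1 + count_mem (c i).1 (take i w)) \in D.
      move: cD; rewrite !mem_skew_diagram /= leq_addr => /andP[_].
      exact: ltn_trans lt2.
    have := f_row _ _ d'D cD erefl lt2.
    by rewrite fc ltnS IH1 //= ltnn.
  have ctake (r : nat) :
    count_mem r (take i.+1 w) = count_mem r (take i w) + ((c i).1 == r).
    by rewrite count_take_nth ?szw // nth_mkseq.
  split=> [d dD|r]; rewrite ctake; last first.
    move: (IH2 r); case: eqVneq => [<- _|_]; last by rewrite addn0.
    by move: cD; rewrite mem_skew_diagram addnA -c2 addn1 => /andP[].
  rewrite leq_eqVlt ltnS IH1 // -fc.
  have -> : (f d == f (c i)) = (d == c i).
    by apply/eqP/eqP => [/(f_inj _ _ dD cD)|->].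
  case: (eqVneq (c i).1 d.1) => [e1|ne1] /=; last first.
    by rewrite addn0; case: eqVneq => // e; rewrite e eqxx in ne1.
  have -> : (d == c i) = (d.2 == (c i).2) by rewrite -pair_eqE /= /pair_eq e1 eqxx.
  by rewrite c2 e1 addn1 addnS ltnS [in RHS]leq_eqVlt.
exists w; have [k1 k2] := key _ (leqnn _); rewrite -szw take_size in k1 k2.
(* A cell still free at the end would have an entry at most [size D], hence would be filled. *)
have sum r : nth 0 mu r + count_mem r w = nth 0 la r.
  apply/eqP; rewrite eqn_leq k2 leqNgt; apply/negP => lt.
  have dD : (r, nth 0 mu r + count_mem r w) \in D by rewrite mem_skew_diagram /= leq_addr.
  by have /andP[_ le] := f_rg _ dD; have := k1 _ dD; rewrite /= ltnn szw le.
split=> // d i dD; case: (leqP i (size D)) => [/key[k _]|/ltnW le]; first exact: k.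
rewrite take_oversize ?szw // -k1 // szw.
have /andP[_ le'] := f_rg _ dD; rewrite le'.
by rewrite (leq_trans le').
Qed.

(** If row [r.+1] became longer than row [r] at time [i], its cell in column [c] would be filled
    before the cell above it. *)
Lemma chain_row_word la mu f w :
  decr (nth 0 la) -> decr (nth 0 mu) -> syt_fun la mu f -> row_word la mu f w ->
  chain (nth 0 mu) w.
Proof.
move=> dla dmu [_ _ _ f_col] [sum fw] i r; rewrite leqNgt; apply/negP => lt.
set c := nth 0 mu r + count_mem r (take i w) in lt.
have := dla r; have := dmu r; have := sum r.+1; have := count_take_le i w r.+1.
move=> h1 h2 h3 h4.
have dD : (r.+1, c) \in skew_diagram la mu.
  by rewrite mem_skew_diagram /=; lia.
have dD' : (r, c) \in skew_diagram la mu.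
  by rewrite mem_skew_diagram /=; lia.
have := f_col _ _ dD' dD erefl (ltnSn r); have := fw _ i dD.
by have := fw _ i dD'; rewrite /= lt ltnn; lia.
Qed.

Lemma decr_le a r s : decr a -> r <= s -> a s <= a r.
Proof.
move=> da; elim: s => [|s IHs]; first by rewrite leqn0 => /eqP->.
by rewrite leq_eqVlt => /predU1P[->|/IHs]; last exact: leq_trans (da s).
Qed.

(** The entry of a cell is the length of the shortest prefix of [w] that fills it. *)
Lemma syt_fun_exists la mu w :
  (forall r : nat, nth 0 mu r + count_mem r w = nth 0 la r) -> chain (nth 0 mu) w ->
  exists2 f, syt_fun la mu f & row_word la mu f w.
Proof.
move=> sum ch; have szw := size_row_word sum.
pose P (d : nat * nat) i := d.2 < nth 0 mu d.1 + count_mem d.1 (take i w).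
pose f d := find (P d) (iota 0 (size w).+1).
have fw d i : d \in skew_diagram la mu -> (f d <= i) = P d i.
  rewrite mem_skew_diagram => dD; apply: find_iota_le.
    move=> m n le; apply/implyP => /leq_trans; apply.
    by rewrite leq_add2l -(subnKC le) takeD count_cat leq_addr.
  by rewrite /P take_size sum; case/andP: dD.
exists f; last by [].
(* The letter that fills a cell determines both its row and its column, whence injectivity. *)
have step d i : d \in skew_diagram la mu -> f d = i.+1 ->
  [/\ i < size w, nth 0 w i = d.1 & d.2 = nth 0 mu d.1 + count_mem d.1 (take i w)].
  move=> dD fd; have := fw d i dD; have := fw d i.+1 dD; rewrite /P fd leqnn ltnn.
  case: (ltnP i (size w)) => lt; last by rewrite !take_oversize //; [move=> <-|lia].
  rewrite count_take_nth //; case: eqVneq => [->|_].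
    rewrite addn1 addnS ltnS => /esym le /esym/negbT; rewrite -leqNgt => ge.
    by split=> //; apply/eqP; rewrite eqn_leq le ge.
  by rewrite addn0 => <-.
have f_gt0 d : d \in skew_diagram la mu -> 0 < f d.
  move=> dD; rewrite ltnNge fw // /P take0 /= addn0 -leqNgt.
  by move: dD; rewrite mem_skew_diagram => /andP[].
have f_inj : {in skew_diagram la mu &, injective f}.
  move=> d d' dD dD' eqf; have := f_gt0 d dD; case fd: (f d) => [//|i] _.
  have [_ e1 e2] := step _ _ dD fd; have [_ e1' e2'] := step _ _ dD' (etrans (esym eqf) fd).
  have e : d.1 = d'.1 by rewrite -e1 e1'.
  by rewrite [d]surjective_pairing [d']surjective_pairing e2 e2' e.
split=> //.
- move=> d dD; rewrite f_gt0 // -szw fw // /P take_size sum.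
  by move: dD; rewrite mem_skew_diagram => /andP[].
- move=> d d' dD dD' e lt; have := f_gt0 d' dD'; case fd: (f d') => [//|i] _.
  have [_ _ e2] := step _ _ dD' fd.
  by rewrite ltnS fw // /P e -e2.
(* Down a column, the weak inequality holds because the shape at time [f d'] is a partition;
   injectivity makes it strict. *)
move=> d d' dD dD' e lt; rewrite ltn_neqAle; apply/andP; split.
  by apply: contraTneq lt => /f_inj-> //; rewrite ltnn.
rewrite fw // /P e; have := leqnn (f d'); rewrite {1}fw // /P => /leq_trans; apply.
exact: (decr_le (ch (f d')) (ltnW lt)).
Qed.

(** If a prefix of [w] had more letters [r] than that of [v], the cell [(r, c)] would be filled
    according to [w] only, while [f] decides for both. *)
Lemma row_word_inj la mu f w v :
  row_word la mu f w -> row_word la mu f v -> w = v.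
Proof.
move=> [sw fw] [sv fv]; have szw := size_row_word sw; have szv := size_row_word sv.
rewrite -[w]take_size -[v]take_size szw szv; apply: eq_take_count; rewrite ?szw ?szv //.
move=> i r _; rewrite leqNgt; apply/negP => lt.
set c := nth 0 mu r + count_mem r (take i v).
have cD : (r, c) \in skew_diagram la mu.
  rewrite mem_skew_diagram /= leq_addr -sw ltn_add2l.
  exact: leq_trans lt (count_take_le _ _ _).
by have := fv _ i cD; rewrite fw //= ltnn ltn_add2l lt.
Qed.

(** * Transfer to the finite type of tableaux *)

Definition entries la mu (t : syt la mu) (d : nat * nat) : nat :=
  if insub d is Some c then entry t c else 0.

Lemma entriesE la mu (t : syt la mu) c : entries t (val c) = entry t c.
Proof. by rewrite /entries valK. Qed.

Lemma cell_val la mu d : d \in skew_diagram la mu -> {c : cell la mu | val c = d}.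
Proof. by move=> dD; exists (SeqSub dD). Qed.

Lemma syt_fun_entries la mu (t : syt la mu) : syt_fun la mu (entries t).
Proof.
have /and4P[/forallP pos /injectiveP inj /forallP row /forallP col] := valP t.
split.
- move=> d /cell_val[c <-]; rewrite entriesE pos /=.
  by rewrite -ltnS /entry ltn_ord.
- move=> _ _ /cell_val[c <-] /cell_val[d <-]; rewrite !entriesE => /val_inj e.
  by congr val; exact: inj.
- move=> _ _ /cell_val[c <-] /cell_val[d <-] /eqP e lt; rewrite !entriesE.
  by have /forallP/(_ d)/implyP := row c; apply; rewrite e lt.
move=> _ _ /cell_val[c <-] /cell_val[d <-] /eqP e lt; rewrite !entriesE.
by have /forallP/(_ d)/implyP := col c; apply; rewrite e lt.
Qed.

Lemma syt_exists la mu f : syt_fun la mu f ->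
  exists t : syt la mu, {in skew_diagram la mu, entries t =1 f}.
Proof.
move=> [rg inj row col].
pose t : filling la mu := [ffun c => inord (f (val c))].
have tE c : t c = f (val c) :> nat.
  by rewrite ffunE inordK // ltnS; case/andP: (rg _ (valP c)).
have st : is_syt t.
  apply/and4P; split.
  - by apply/forallP => c; rewrite tE; case/andP: (rg _ (valP c)).
  - apply/injectiveP => c d /(congr1 val); rewrite /= !tE => /inj e.
    by apply: val_inj; apply: e; exact: valP.
  - apply/forallP => c; apply/forallP => d; apply/implyP => /andP[/eqP e lt].
    by rewrite !tE; apply: row => //; exact: valP.
  apply/forallP => c; apply/forallP => d; apply/implyP => /andP[/eqP e lt].
  by rewrite !tE; apply: col => //; exact: valP.
exists (exist _ t st) => _ /cell_val[c <-].
by rewrite entriesE /entry tE.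
Qed.

Lemma entries_inj la mu (t u : syt la mu) :
  {in skew_diagram la mu, entries t =1 entries u} -> t = u.
Proof.
move=> e; apply: val_inj; apply/ffunP => c; apply: val_inj.
by have := e _ (valP c); rewrite !entriesE.
Qed.

Lemma row_word_entries_inj la mu (t u : syt la mu) w :
  row_word la mu (entries t) w -> row_word la mu (entries u) w -> t = u.
Proof.
move=> [_ tw] [_ uw]; apply: entries_inj => d dD; apply/eqP.
by rewrite eqn_leq tw // -uw // leqnn uw // -tw // leqnn.
Qed.

(** * Padded partitions as row-length functions *)

Lemma size_parts m (p : intpart m) : size p = m.
Proof. by rewrite size_map size_tuple. Qed.

Lemma decr_parts m (p : intpart m) : decr (nth 0 p).
Proof.
move=> r; have /andP[sp _] := valP p.
case: (ltnP r.+1 (size p)) => lt; last by rewrite nth_default.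
exact: (sortedP 0 sp).
Qed.

Lemma sumn_parts m (p : intpart m) : sumn p = m.
Proof. by have /andP[_ /eqP] := valP p. Qed.

Lemma intpart_inj m (p q : intpart m) : nth 0 p =1 nth 0 q -> p = q.
Proof.
move=> e; apply: val_inj; apply: val_inj; apply: (inj_map val_inj).
by apply: (@eq_from_nth _ 0) => [|i _]; [rewrite !size_map !size_tuple | exact: e].
Qed.

(** Whatever the bound [B], a partition of [m] has at most [m] nonzero rows, each at most [m], so it
    fits into the padded tuple. *)
Lemma intpart_exists B m a : decr a -> (forall r, B <= r -> a r = 0) ->
  \sum_(r < B) a r = m -> exists p : intpart m, nth 0 p =1 a.
Proof.
move=> da a0 sum.
have sumN N : B <= N -> \sum_(r < N) a r = m.
  move=> le; rewrite -sum -!(big_mkord xpredT) (big_cat_nat (n := B)) //=.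
  rewrite [X in _ + X]big_nat_cond [X in _ + X]big1 ?addn0 // => r.
  by rewrite andbT => /andP[/a0].
(* A nonempty row [r >= m] would force [r.+1] nonempty rows, with total more than [m]. *)
have am r : m <= r -> a r = 0.
  move=> le; apply/eqP; rewrite -leqn0 leqNgt; apply/negP => gt0.
  have := sumN (maxn B r.+1) (leq_maxl _ _); apply/eqP; rewrite gtn_eqF //.
  apply: leq_trans (_ : r.+1 <= _) => //.
  rewrite -(big_mkord xpredT) (big_cat_nat (n := r.+1)) ?leq_maxr //=.
  apply: leq_trans (leq_addr _ _); rewrite big_mkord -[X in X <= _]card_ord -sum1_card.
  apply: leq_sum => i _; apply: leq_trans gt0 _; apply: decr_le => //.
  by rewrite -ltnS.
have summ : \sum_(r < m) a r = m.
  have := sumN (maxn B m) (leq_maxl _ _).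
  rewrite -(big_mkord xpredT) (big_cat_nat (n := m)) ?leq_maxr //= big_mkord => e.
  rewrite -[RHS]e.
  rewrite [X in _ + X]big_nat_cond [X in _ + X]big1 ?addn0 // => r.
  by rewrite andbT => /andP[/am].
have le_am (i : 'I_m) : a i < m.+1 by rewrite ltnS -{2}summ (bigD1 i) //= leq_addr.
pose p := [tuple Ordinal (le_am i) | i < m].
have pE : map val p = mkseq a m.
  by rewrite -map_comp /mkseq -val_enum_ord -[in RHS]map_comp; apply: eq_map.
have ip : is_partition p.
  rewrite /is_partition pE; apply/andP; split; last first.
    by rewrite sumnE big_map -[iota _ _]/(iota 0 m) -[m in iota _ m]subn0 big_mkord summ.
  apply/(sortedP 0) => i; rewrite size_mkseq => lt.
  by rewrite !nth_mkseq ?(ltnW lt) //; exact: da.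
exists (exist _ p ip) => r; rewrite /parts /= pE.
case: (ltnP r m) => lt; first by rewrite nth_mkseq.
by rewrite nth_default ?size_mkseq // am.
Qed.

(** * Tableau counts as word counts *)

Lemma eq_row_word la mu f g w : {in skew_diagram la mu, g =1 f} ->
  row_word la mu f w -> row_word la mu g w.
Proof. by move=> e [sum fw]; split=> // d i dD; rewrite e // fw. Qed.

Lemma all_gtn_widen m n w : m <= n -> all (gtn m) w -> all (gtn n) w.
Proof. by move=> le; apply: sub_all => i /= lt; exact: leq_trans lt le. Qed.

Lemma row_word_syt_exists la mu w :
  (forall r, nth 0 mu r + count_mem r w = nth 0 la r) -> chain (nth 0 mu) w ->
  exists t : syt la mu, row_word la mu (entries t) w.
Proof.
move=> sum /(syt_fun_exists sum)[f /syt_exists[t tf] fw].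
by exists t; exact: eq_row_word tf fw.
Qed.

(** Pairs of a shape [mu] and a tableau of shape [al / mu] correspond to down words; [mu] is
    recovered from [al] and the word. *)
Lemma sum_num_syt k (al : intpart k) j B : j <= k -> k <= B ->
  \sum_(mu : intpart (k - j)) num_syt al mu = size (down_words B j (nth 0 al)).
Proof.
move=> le_jk le_kB.
have al0 r : k <= r -> nth 0 al r = 0 by move=> ?; rewrite nth_default ?size_parts.
have sum_al : \sum_(r < k) nth 0 al r = k by rewrite sum_nth ?size_parts // sumn_parts.
(* [num_syt] is set to [0] outside [subshape], where the type [syt al mu] may still be inhabited. *)
pose A := [set p : {mu : intpart (k - j) & syt al mu} | subshape (tag p) al].
have -> : \sum_(mu : intpart (k - j)) num_syt al mu = #|A|.
  transitivity (\sum_(mu : intpart (k - j)) \sum_(t : syt al mu) (subshape mu al : nat)).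
    apply: eq_bigr => mu _; rewrite sum_nat_const /num_syt.
    by case: ifP; rewrite ?muln1 ?muln0.
  rewrite (sig_big_dep xpredT (fun _ => xpredT)
    (fun (mu : intpart (k - j)) (t : syt al mu) => subshape mu al : nat)) /=.
  by rewrite -sum1dep_card [RHS]big_mkcond; apply: eq_bigr => p _; case: subshape.
pose R (p : {mu : intpart (k - j) & syt al mu}) w :=
  row_word al (tag p) (entries (tagged p)) w.
apply: (@card_rel _ _ _ _ R).
- exact: down_words_uniq.
- case=> mu t; rewrite inE /= => sub.
  have [w tw] := row_word_exists sub (syt_fun_entries t).
  have [sum _] := tw.
  exists w => //; apply/mem_down_words; first exact: decr_parts.
  have lw := row_word_letters sum; rewrite size_parts in lw.
  split; last 1 first.
  + exists (nth 0 (mu : intpart (k - j))) => //.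
    by apply: chain_row_word tw;
      [exact: decr_parts | exact: decr_parts | exact: syt_fun_entries].
  + have := sum_al; under eq_bigr do rewrite -sum.
    rewrite big_split /= sum_count_mem // sum_nth ?size_parts ?leq_subr // sumn_parts.
    lia.
  exact: all_gtn_widen lw.
- move=> w /mem_down_words-/(_ (decr_parts _))[szw _ [a sum ch]].
  have a0 r : k <= r -> a r = 0 by move=> /al0; rewrite -sum; lia.
  have suma : \sum_(r < k) a r = k - j.
    have lw : all (gtn k) w.
      apply/allP => r; rewrite -has_pred1 has_count => cr /=; rewrite ltnNge.
      by apply: contraL cr => /al0; have := sum r; lia.
    have := sum_al; under eq_bigr do rewrite -sum.
    by rewrite big_split /= sum_count_mem // szw; lia.
  have [mu muE] := intpart_exists (chain0 ch) a0 suma.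
  have sum' r : nth 0 mu r + count_mem r w = nth 0 al r by rewrite muE.
  have [|t tw] := row_word_syt_exists sum'; first exact: eq_chain (fsym muE) ch.
  exists (Tagged (fun mu : intpart (k - j) => syt al mu) t) => //.
  by rewrite inE /=; apply/subshapeP => r; rewrite -sum' leq_addr.
- by move=> p w v; exact: row_word_inj.
move=> [mu t] [nu u] w; rewrite /R /= => tw uw.
have e : mu = nu.
  by apply: intpart_inj => r; case: tw uw => s1 _ [s2 _]; have := s1 r; have := s2 r; lia.
by subst nu; rewrite (row_word_entries_inj tw uw).
Qed.

(** Prefixes of length [i] encode the cells with entries at most [i], so containing [T] means
    starting with its word. *)
Lemma contains_sytP la al (t : syt la [::]) (T : syt al [::]) w v :
  row_word la [::] (entries t) w -> row_word al [::] (entries T) v ->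
  size v <= size w ->
  reflect (take (size v) w = v) (contains_syt t T).
Proof.
move=> tw Tv le; have [sw fw] := tw; have [sv fv] := Tv.
have szv := size_row_word sv.
apply: (iffP andP) => [[/forallP h1 /forallP h2]|ewv].
  rewrite -[RHS]take_size; apply: eq_take_count => // i r lei.
  (* The cell [(r, c)] has entry at most [i] in [t], so it lies in [al] with the same entry in [T];
     but the prefix of [v] does not fill it. *)
  rewrite leqNgt; apply/negP => lt.
  set c := count_mem r (take i v) in lt.
  have dD : (r, c) \in skew_diagram la [::].
    rewrite mem_skew_diagram /= nth_nil -sw nth_nil.
    exact: leq_trans lt (count_take_le _ _ _).
  have [x xE] := cell_val dD.
  have tle : entry t x <= i by rewrite -entriesE xE fw //= nth_nil.
  have := h1 x; rewrite -szv (leq_trans tle lei) xE => /eqP/esym/cell_val[y yE].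
  have /forallP/(_ y)/implyP := h2 x; rewrite xE yE eqxx => /(_ isT)/eqP eT.
  have : entries T (r, c) <= i by rewrite -yE entriesE -eT.
  by rewrite fv -?yE ?(valP y) // yE /= nth_nil ltnn.
have ewv' i r : i <= size v -> count_mem r (take i w) = count_mem r (take i v).
  by move=> lei; rewrite -ewv take_takel.
have tT d : d \in skew_diagram la [::] -> d \in skew_diagram al [::] ->
  entries t d = entries T d.
  move=> dl da; have leT : entries T d <= size v.
    by have [+ _ _ _] := syt_fun_entries T; rewrite szv => /(_ d da)/andP[].
  have let' : entries t d <= size v.
    by rewrite fw // ewv' // -fv.
  by apply/eqP; rewrite eqn_leq fw // ewv' // -fv // leqnn fv // -ewv' // -fw // leqnn.
split.
  apply/forallP => c; rewrite -entriesE -szv fw ?(valP c) // ewv' // take_size.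
  by rewrite sv mem_skew_diagram nth_nil.
apply/forallP => c; apply/forallP => d; apply/implyP => /eqP e.
by rewrite -!entriesE e tT // -?e ?(valP c) // e (valP d).
Qed.

(** With [v] the word of [T], the tableaux containing [T] are those with word [v ++ w], where [w] is
    an up word from [al]. *)
Lemma num_syt_containingE k (al : intpart k) (T : syt al [::]) n B : n + k <= B ->
  num_syt_containing (n + k) T = size (up_words B n (nth 0 al)).
Proof.
move=> leB.
have nil_decr : decr (nth 0 [::]) by move=> r; rewrite !nth_nil.
have sub0 (la : seq nat) : subshape [::] la by [].
have size_word m (la : intpart m) w :
  (forall r, nth 0 [::] r + count_mem r w = nth 0 la r) -> size w = m.
  move=> sum; have lw := row_word_letters sum.
  rewrite -(sum_count_mem lw) -[RHS](sumn_parts la) -(sum_nth (leqnn _)).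
  by apply: eq_bigr => r _; rewrite -sum nth_nil.
have [v Tv] := row_word_exists (sub0 al) (syt_fun_entries T).
have [sv _] := Tv; have szv := size_word _ _ _ sv.
have chv : chain (nth 0 [::]) v.
  by apply: chain_row_word Tv => //; [exact: decr_parts | exact: syt_fun_entries].
pose R (p : syt_of_size (n + k)) w :=
  row_word (tag p) [::] (entries (tagged p)) (v ++ w).
apply: (@card_rel _ _ _ _ R).
- exact: up_words_uniq.
- move=> [la t]; rewrite inE /= => ct.
  have [w tw] := row_word_exists (sub0 _) (syt_fun_entries t).
  have [sw _] := tw; have szw := size_word _ _ _ sw.
  have ew : v ++ drop k w = w.
    rewrite -[RHS](cat_take_drop k); congr (_ ++ _).
    by rewrite -szv (contains_sytP tw Tv _ ct) // szv szw leq_addl.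
  exists (drop k w); last by rewrite /R /= ew.
  apply/mem_up_words; first exact: decr_parts.
  have chw : chain (nth 0 [::]) w.
    by apply: chain_row_word tw => //; [exact: decr_parts | exact: syt_fun_entries].
  split.
  + by rewrite size_drop szw addnK.
  + have := row_word_letters sw; rewrite size_parts => /(all_gtn_widen leB).
    by rewrite -{1}ew all_cat => /andP[].
  by move: chw; rewrite -{1}ew => /chain_cat[_ /(eq_chain sv)].
- move=> w /mem_up_words-/(_ (decr_parts _))[szw lw chw].
  have ch : chain (nth 0 [::]) (v ++ w).
    by apply/chain_cat; split=> //; exact: eq_chain (fsym sv) chw.
  have lv := row_word_letters sv; rewrite size_parts in lv.
  have lvw : all (gtn B) (v ++ w).
    by rewrite all_cat lw (all_gtn_widen _ lv) // (leq_trans _ leB) ?leq_addl.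
  pose a r := count_mem r (v ++ w).
  have da : decr a by move=> r; have := ch (size (v ++ w)) r; rewrite take_size !nth_nil.
  have a0 r : B <= r -> a r = 0.
    move=> le; apply/count_memPn; apply: contraTN le => /(allP lvw) /=.
    by rewrite ltnNge.
  have suma : \sum_(r < B) a r = n + k.
    by rewrite sum_count_mem // size_cat szv szw addnC.
  have [la laE] := intpart_exists da a0 suma.
  have sum r : nth 0 [::] r + count_mem r (v ++ w) = nth 0 la r by rewrite nth_nil laE.
  have [t tw] := row_word_syt_exists sum ch.
  exists (Tagged (fun la : intpart (n + k) => syt la [::]) t) => //.
  rewrite inE /=; apply/(contains_sytP tw Tv); rewrite ?size_cat ?leq_addr //.
  by rewrite take_size_cat.
- move=> p w u pw pu; have := row_word_inj pw pu.
  by move/(congr1 (drop (size v))); rewrite !drop_size_cat.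
move=> [la t] [nu u] w; rewrite /R /= => tw uw.
have e : la = nu.
  by apply: intpart_inj => r; case: tw uw => s1 _ [s2 _]; rewrite -s1 -s2.
by subst nu; rewrite (row_word_entries_inj tw uw).
Qed.

(** Each letter of a down word removes one of only [k] boxes. *)
Lemma size_down_words0 k (al : intpart k) j B : k <= B -> k < j ->
  size (down_words B j (nth 0 al)) = 0.
Proof.
move=> leB ltkj; case e: (down_words _ _ _) => [//|w s].
have [] := (mem_down_words B j w (@decr_parts k al)).1; first by rewrite e mem_head.
move=> szw lw [mu sum _]; suff : size w <= k by rewrite szw leqNgt ltkj.
rewrite -(sum_count_mem lw) -[X in _ <= X](sumn_parts al) -(@sum_nth B) ?size_parts //.
by apply: leq_sum => r _; rewrite -sum leq_addl.
Qed.

Theorem theorem2p2 (k : nat) (alpha : intpart k) (T : syt alpha [::]) (n : nat) :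
  num_syt_containing (n + k) T =
    \sum_(0 <= j < k.+1)
      'C(n, j) * (\sum_(mu : intpart (k - j)) num_syt alpha mu)
               * num_involutions (n - j).
Proof.
(* The bound is [B.+1] with [B = n + k]: [alpha] is empty from row [k = B - n] on. *)
rewrite (@num_syt_containingE _ _ _ _ (n + k).+1) //.
rewrite (size_up_words num_involutions0 num_involutionsS) ?leq_addr //; first last.
- by move=> i; rewrite leq_add2l => le; rewrite nth_default ?size_parts.
- exact: decr_parts.
pose F j :=
  'C(n, j) * size (down_words (n + k).+1 j (nth 0 alpha)) * num_involutions (n - j).
(* Both sums extend to this common range: the binomial vanishes for [j > n], the down words for
   [j > k]. *)
transitivity (\sum_(0 <= j < (n + k).+1) F j).
  rewrite [RHS](big_cat_nat (n := n.+1)) ?ltnS ?leq_addr //=.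
  rewrite [X in _ = _ + X]big1_seq ?addn0 // => j; rewrite mem_index_iota /F.
  by move=> /andP[_ /andP[lt _]]; rewrite bin_small.
rewrite (big_cat_nat (n := k.+1)) ?ltnS ?leq_addl //=.
rewrite [X in _ + X]big1_seq ?addn0 => [|j].
  rewrite !big_nat; apply: eq_bigr => j /andP[_ lt].
  by rewrite (@sum_num_syt _ _ _ (n + k).+1) // leqW ?leq_addl.
rewrite mem_index_iota /F => /andP[_ /andP[lt _]].
by rewrite size_down_words0 ?muln0 // leqW ?leq_addl.
Qed.
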